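(* The number of locally-valid MV assignments of any $m\times n$ snake tessellation is equal to the number of locally-valid MV assignments of an $m\times n$ standard Miura-ori, and also to that of an $m\times n$ modified Miura-ori.
   Context: **Modified Miura-ori.** An $m\times n$ modified Miura-ori crease pattern is formed by $m-1$ straight horizontal crease lines crossed by $n-1$ vertical zig-zag columns of creases. In coordinates: the horizontal creases lie on the lines $y=i$, $1\le i\le m-1$, of the paper $P$ with $0\le y\le m$; for $1\le j\le n-1$ the $j$-th zig-zag is the polyline through the points $p_{i,j}=(x_j+\epsilon_j(-1)^i\delta,\; i)$, $i=0,\dots,m$, where $\delta>0$, $\epsilon_j\in\{1,-1\}$, and $x_1<\cdots<x_{n-1}$ are spaced so that the zig-zags are pairwise disjoint and interior to the left and right edges of $P$. The interior vertices are the $p_{i,j}$ with $1\le i\le m-1$, $1\le j\le n-1$; the creases are the segments into which the horizontal lines and zig-zags are cut by these vertices. The standard Miura-ori is the case where all $\epsilon_j$ are equal; a modified Miura-ori has arbitrary signs $\epsilon_j$ (some zig-zag columns reflected left to right). Every interior vertex is a bird's foot: two consecutive equal acute sector angles $\theta$ bordered by three creases (the toes), and two equal obtuse sector angles $\pi-\theta$ meeting at the fourth crease (the heel, collinear with the middle toe). **Snake tessellation.** An $m\times n$ snake tessellation is a crease pattern defined in the same way, except that some pairs of consecutive zig-zags $j,j+1$ with $\epsilon_{j+1}=-\epsilon_j$ are moved together until they touch ($x_{j+1}-x_j=2\delta$), so that at every row $i$ with $\epsilon_j(-1)^i=1$ the two bird's feet $p_{i,j}$ and $p_{i,j+1}$,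 which in the corresponding modified Miura-ori share a common heel, coincide and form a single degree-6 vertex (a waterbomb vertex), the shared heel having been contracted away. A waterbomb vertex thus has cyclic sector angles $\theta,\theta,\pi-2\theta,\theta,\theta,\pi-2\theta$ with $\theta<\pi-2\theta$; the two triples of creases $\{w_1,w_2,w_3\}$ and $\{w_4,w_5,w_6\}$ bordering the two pairs of consecutive angles $\theta$ are the toes of the two merged bird's feet. All other interior vertices are bird's feet. Splitting each waterbomb vertex into two bird's feet sharing a heel gives the corresponding $m\times n$ modified Miura-ori. **MV assignments.** A MV assignment is a function $\mu$ from the set of creases to $\{1,-1\}$ (mountain $=1$, valley $=-1$). It is locally-valid if at each interior vertex the creases at that vertex fold flat without self-intersection. Known characterization: a bird's foot is validly assigned iff $\mu(\text{heel})$ equals the sum of $\mu$ over the three toes; a waterbomb vertex is validly assigned iff $\mu(w_1)+\mu(w_2)+\mu(w_3)=\pm1$, $\mu(w_4)+\mu(w_5)+\mu(w_6)=\pm1$, and $\sum_{i=1}^6\mu(w_i)=\pm2$. *)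

(* Defs.v *)
From mathcomp Require Import all_boot all_order all_fingroup all_algebra.
From mathcomp Require Import all_classical all_reals all_analysis.

Set Implicit Arguments.
Unset Strict Implicit.
Unset Printing Implicit Defensive.

Import Order.TTheory GRing.Theory Num.Theory.

Local Open Scope ring_scope.

(* Mountain is [true] (the sign 1), valley is [false] (the sign -1). *)
Definition mv := bool.

Section FlatFoldability.
Variable R : realType.

(* Direction in [0, 2 pi[ of a nonzero vector of the plane. *)
Definition direction (v : R * R) : R :=
  let t := acos (v.1 / Num.sqrt (v.1 ^+ 2 + v.2 ^+ 2)) in
  if 0 <= v.2 then t else 2 * pi - t.

(* A single-vertex crease pattern is the list [s] of its creases in
   counterclockwise order, each given by its direction in [0, 2 pi[ and its
   fold. Sector [i] lies between crease [i] and the cyclically next crease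
   [ordS i]; hence crease [i] separates the sectors [ord_pred i] and [i]. *)
Variable s : seq (R * mv).
Notation k := (size s).

Definition crease_direction (i : 'I_k) : R := (nth (0, false) s i).1.
Definition crease_mv (i : 'I_k) : mv := (nth (0, false) s i).2.

Definition sector_angle (i : 'I_k) : R :=
  if (i.+1 < k)%N then crease_direction (ordS i) - crease_direction i
  else crease_direction (ordS i) + 2 * pi - crease_direction i.

(* Position of crease [i] once all the creases are folded flat, measured on the
   arc onto which a small circle around the vertex is folded: the even sectors
   keep their orientation, the odd ones are reversed. *)
Definition folded_position (i : 'I_k) : R :=
  \sum_(j < k | (j < i)%N) (-1) ^+ j * sector_angle j.

Definition in_sector_interior (i l : 'I_k) : bool :=
  Num.min (folded_position l) (folded_position (ordS l)) < folded_position i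
    < Num.max (folded_position l) (folded_position (ordS l)).

(* The stacking order of the sectors in the flat folded state; greater is
   higher. *)
Variable layer : {perm 'I_k}.

(* The layer of sector [l] is between the two sectors joined at crease [i]. *)
Definition layer_between (i l : 'I_k) : bool :=
  (minn (layer (ord_pred i)) (layer i) < layer l
     < maxn (layer (ord_pred i)) (layer i))%N.

(* At a valley the two upper sides face each other, so sector [i] is stacked
   above sector [ord_pred i] when the latter is face up (even), and below it
   when the latter is face down (odd); at a mountain it is the opposite. *)
Definition layer_respects_mv : Prop :=
  forall i : 'I_k,
    ~~ crease_mv i
    = ((layer (ord_pred i) < layer i)%N (+) odd (ord_pred i)).

(* No sector passes through a crease located in its interior. *)
Definition no_sector_crease_crossing : Prop :=
  forall i l : 'I_k, in_sector_interior i l -> ~~ layer_between i l.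

(* Two creases folded onto the same position, with their sectors on the same
   side of it, are nested or disjoint. Around crease [i] both sectors are on the
   increasing side if [i] is even, and on the decreasing side if [i] is odd. *)
Definition no_crease_crease_crossing : Prop :=
  forall i l : 'I_k, i != l -> odd i = odd l ->
    folded_position i = folded_position l ->
    layer_between i (ord_pred l) = layer_between i l.

End FlatFoldability.

(* The first two conditions say that the folding map closes up around the
   vertex, the last one that the sectors can be stacked without
   self-intersection. *)
Definition flat_foldable (R : realType) (s : seq (R * mv)) : Prop :=
  [/\ ~~ odd (size s),
      \sum_(i < size s) (-1) ^+ i * sector_angle i = 0
    & exists layer : {perm 'I_(size s)},
        [/\ layer_respects_mv layer,
            no_sector_crease_crossing layer
          & no_crease_crease_crossing layer]].

(* The data of a pattern of m - 1 horizontal crease lines and n - 1 zig-zags.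
   Only the values of [abscissa] and [reflected] at the indices 1, ..., n - 1 are
   meaningful; [reflected j] says that the sign epsilon_j is -1. *)
Record zigzag_pattern (R : realType) (m n : nat) := ZigzagPattern {
  left_edge : R;
  right_edge : R;
  delta : R;
  abscissa : nat -> R;
  reflected : nat -> bool }.

Section CreasePattern.
Variables (R : realType) (m n : nat) (L : zigzag_pattern R m n).

Definition zigzag_point (i j : nat) : R * R :=
  (abscissa L j + (-1) ^+ reflected L j * (-1) ^+ i * delta L, i%:R).

(* The columns 0 and n are the points of the edges of the paper. *)
Definition grid_point (i j : nat) : R * R :=
  if j == 0%N then (left_edge L, i%:R)
  else if j == n then (right_edge L, i%:R)
  else zigzag_point i j.

Definition zigzag (j : nat) : set (R * R) :=
  ([set q | exists i : nat, exists t : R, [/\ (i < m)%N, 0 <= t <= 1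
    & q = ((1 - t) * (zigzag_point i j).1 + t * (zigzag_point i.+1 j).1,
           (1 - t) * (zigzag_point i j).2 + t * (zigzag_point i.+1 j).2)]])%classic.

(* [inl (i, j)] is the segment of the line y = i + 1 between the columns j and
   j + 1, and [inr (i, j)] the segment of the zig-zag j + 1 between the lines
   y = i and y = i + 1. *)
Definition piece : finType := ('I_m.-1 * 'I_n + 'I_m * 'I_n.-1)%type.

Definition endpoints (c : piece) : (R * R) * (R * R) :=
  match c with
  | inl (i, j) => (grid_point i.+1 j, grid_point i.+1 j.+1)
  | inr (i, j) => (grid_point i j.+1, grid_point i.+1 j.+1)
  end.

(* A piece reduced to a point, i.e. a heel contracted between two touching
   zig-zags, is not a crease. *)
Definition crease : finType := {c : piece | (endpoints c).1 != (endpoints c).2}.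

Definition incident (v : R * R) (c : crease) : bool :=
  (v == (endpoints (val c)).1) || (v == (endpoints (val c)).2).

(* The direction in which [c] leaves its endpoint [v]. *)
Definition direction_from (v : R * R) (c : crease) : R :=
  let e := endpoints (val c) in
  let w := if v == e.1 then e.2 else e.1 in
  direction (w.1 - v.1, w.2 - v.2).

Definition creases_at (v : R * R) : seq crease :=
  sort (fun c d => direction_from v c <= direction_from v d)
    (enum (incident v)).

(* Touching zig-zags give several index pairs (i, j) for the same vertex. *)
Definition locally_valid (mu : {ffun crease -> mv}) : Prop :=
  forall i j : nat, (0 < i < m)%N -> (0 < j < n)%N ->
    let v := grid_point i j in
    flat_foldable [seq (direction_from v c, mu c) | c <- creases_at v].

Definition num_locally_valid : nat :=
  #|[set mu : {ffun crease -> mv} | `[< locally_valid mu >]]%SET|.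

(* The acute angle between the zig-zag creases and the horizontal ones. *)
Definition theta : R := direction (2 * delta L, 1).

Definition well_placed : Prop :=
  [/\ 0 < delta L,
      left_edge L < right_edge L,
      forall j k : nat, (0 < j)%N -> (j < k)%N -> (k < n)%N ->
        abscissa L j < abscissa L k
    & forall i j : nat, (i <= m)%N -> (0 < j < n)%N ->
        left_edge L < (zigzag_point i j).1 < right_edge L].

Definition modified_miura_ori : Prop :=
  well_placed /\
  forall j k : nat, (0 < j)%N -> (j < k)%N -> (k < n)%N ->
    (zigzag j `&` zigzag k = set0)%classic.

Definition standard_miura_ori : Prop :=
  modified_miura_ori /\
  forall j k : nat, (0 < j < n)%N -> (0 < k < n)%N ->
    reflected L j = reflected L k.

Definition touching (j k : nat) : Prop :=
  [/\ k = j.+1, reflected L k = ~~ reflected L j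
    & abscissa L k - abscissa L j = 2 * delta L].

(* The last condition is the inequality between the two kinds of sector angles
   at each waterbomb vertex. *)
Definition snake_tessellation : Prop :=
  [/\ well_placed,
      forall j k : nat, (0 < j)%N -> (j < k)%N -> (k < n)%N ->
        (zigzag j `&` zigzag k = set0)%classic \/ touching j k
    & forall i j : nat, (0 < i < m)%N -> (0 < j)%N -> (j.+1 < n)%N ->
        zigzag_point i j = zigzag_point i j.+1 ->
        theta < pi - 2 * theta].

End CreasePattern.

(* Main.v *)
Require Import Defs.
From mathcomp Require Import all_boot all_order all_algebra.
From mathcomp Require Import all_classical all_reals all_analysis.
From mathcomp Require Import all_fingroup ring lra zify.

(* Multiply the fold of each zig-zag crease by epsilon_j (-1)^i. At every bird's
   foot, whichever way it points, the rule heel = sum of the toes then becomes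
   east - west = north - south, which no longer involves the signs epsilon_j. At
   a waterbomb vertex both triples of toes have the same sum +1 or -1; giving
   this value to the contracted heel is the only way to satisfy that rule at the
   two merged feet. Hence the locally-valid assignments of every m x n snake
   tessellation are in bijection with the solutions of the same system of
   equations, and a modified Miura-ori is a snake tessellation. *)

Set Implicit Arguments.
Unset Strict Implicit.
Unset Printing Implicit Defensive.

Import Order.TTheory GRing.Theory Num.Theory.

Local Open Scope ring_scope.

(** * Flat foldability at one vertex as a finite computation *)

(* [flat_foldable] as a finite check: [l] lists the layers of the sectors, and
   [r] the ranks of the folded positions of the creases, since only the
   comparisons between these positions matter. The [if] stands for [&&], both
   sides of which [vm_compute] would evaluate. *)
Definition stackable (r : seq nat) (mus : seq bool) (l : seq nat) : bool :=
  let k := size r in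
  let prev i := ((i + k).-1 %% k)%N in
  let next i := (i.+1 %% k)%N in
  let pos := nth 0%N r in
  let lay := nth 0%N l in
  let between i q :=
    (minn (lay (prev i)) (lay i) < lay q < maxn (lay (prev i)) (lay i))%N in
  if all (fun i => ~~ nth false mus i == ((lay (prev i) < lay i)%N (+) odd (prev i)))
    (iota 0 k)
  then all (fun i => all (fun q =>
       ((minn (pos q) (pos (next q)) < pos i < maxn (pos q) (pos (next q)))%N
          ==> ~~ between i q)
       && ([&& i != q, odd i == odd q & pos i == pos q]
          ==> (between i (prev q) == between i q)))
     (iota 0 k)) (iota 0 k)
  else false.

Lemma all_iotaP (k : nat) (P : pred nat) :
  reflect (forall i : 'I_k, P i) (all P (iota 0 k)).
Proof.
apply: (iffP allP) => [H i|H i]; first by apply: H; rewrite mem_iota /=.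
by rewrite mem_iota /= => ik; exact: (H (Ordinal ik)).
Qed.

(** Passing from permutations of ['I_k] to enumerated lists turns the existence of a stacking order
    into a boolean that [vm_compute] evaluates. *)
Lemma layer_seqP (k : nat) (Q : seq nat -> bool) (P : {perm 'I_k} -> Prop) :
  (forall l (layer : {perm 'I_k}), (forall i : 'I_k, nth 0%N l i = layer i) ->
    Q l <-> P layer) ->
  (exists layer, P layer) <-> has Q (permutations (iota 0 k)).
Proof.
move=> QP; split=> [[layer Pl]|/hasP[l]].
- apply/hasP; exists [seq val (layer i) | i <- enum 'I_k].
  + rewrite mem_permutations -val_enum_ord (map_comp val layer) perm_map //.
    apply: uniq_perm; rewrite ?(map_inj_uniq perm_inj) ?enum_uniq // => i.
    rewrite mem_enum; apply/mapP; exists (layer^-1 i)%g.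
    * by rewrite mem_enum.
    * by rewrite permKV.
  + apply/(QP _ layer) => // i.
    by rewrite (nth_map i) ?size_enum_ord// nth_ord_enum.
rewrite mem_permutations => pl Ql.
have sl : size l = k by rewrite (perm_size pl) size_iota.
have lk i : (i < k)%N -> (nth 0%N l i < k)%N.
  move=> ik; suff : nth 0%N l i \in iota 0 k by rewrite mem_iota.
  by rewrite -(perm_mem pl) mem_nth// sl.
pose f (i : 'I_k) := Ordinal (lk i (ltn_ord i)).
have finj : injective f.
  move=> i j /(congr1 val)/= /eqP; rewrite nth_uniq ?sl//; first by move/eqP/val_inj.
  by rewrite (perm_uniq pl) iota_uniq.
exists (perm finj); apply/(QP l) => // i.
by rewrite permE.
Qed.

Section Stacking.
Variables (R : realType) (s : seq (R * mv)) (r : seq nat).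
Hypothesis size_r : size r = size s.
Hypothesis rank_r : forall i j : 'I_(size s),
  (folded_position i < folded_position j) = (nth 0 r i < nth 0 r j)%N.

Lemma rank_eq (i j : 'I_(size s)) :
  folded_position i = folded_position j <-> nth 0%N r i = nth 0%N r j.
Proof.
suff E : (folded_position i == folded_position j) = (nth 0 r i == nth 0 r j)%N.
  by split=> /eqP H; apply/eqP; rewrite ?E // -E.
move: (rank_r i j) (rank_r j i).
by case: (ltgtP (folded_position i)); case: (ltngtP (nth 0%N r i)).
Qed.

Lemma stackableP :
  (exists layer : {perm 'I_(size s)},
    [/\ layer_respects_mv layer, no_sector_crease_crossing layer
      & no_crease_crease_crossing layer])
  <-> has (stackable r [seq x.2 | x <- s]) (permutations (iota 0 (size s))).
Proof.
apply: layer_seqP => l layer ll.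
rewrite /stackable size_r.
have mvE (i : 'I_(size s)) : nth false [seq x.2 | x <- s] i = crease_mv i.
  by rewrite (nth_map (0, false)).
have prevE (i : 'I_(size s)) : ((i + size s).-1 %% size s)%N = ord_pred i by [].
have nextE (i : 'I_(size s)) : (i.+1 %% size s)%N = ordS i by [].
split=> [/andP[/all_iotaP H1 /all_iotaP H2]|[H1 H2 H3]].
- split=> [i|i q|i q].
  + by have /eqP := H1 i; rewrite mvE !prevE !ll.
  + move=> iq; have /all_iotaP/(_ q)/andP[+ _] := H2 i.
    rewrite nextE !prevE !ll => /implyP; apply.
    by move: iq; rewrite /in_sector_interior gt_min lt_max !rank_r gtn_min leq_max.
  + move=> niq oiq piq; have /all_iotaP/(_ q)/andP[_ +] := H2 i.
    rewrite !prevE !ll => /implyP H; apply/eqP/H.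
    by rewrite niq oiq eqxx; apply/eqP/rank_eq.
- apply/andP; split; first by apply/all_iotaP => i; rewrite mvE prevE !ll H1.
  apply/all_iotaP => i; apply/all_iotaP => q; apply/andP; split; apply/implyP.
  + rewrite nextE !prevE !ll => iq; apply: (H2 i q).
    by move: iq; rewrite /in_sector_interior gt_min lt_max !rank_r gtn_min leq_max.
  + move=> /and3P[niq /eqP oiq /eqP/rank_eq piq]; rewrite !prevE !ll.
    by apply/eqP/H3.
Qed.

End Stacking.

(** * Folding rules of bird's feet and waterbomb vertices *)

(* The folded positions are 0, pi - t, pi - 2 t, pi - t for a foot with its heel
   to the right, and 0, t, 2 t - pi, t for one with its heel to the left. *)
Lemma stackable_foot_right : forall h t1 t2 t3 : bool,
  has (stackable [:: 0; 2; 1; 2]%N [:: h; t1; t2; t3]) (permutations (iota 0 4))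
  = (h + 1 == t1 + t2 + t3)%N.
Proof. by do 4!case; vm_compute. Qed.

Lemma stackable_foot_left : forall t2 t1 h t3 : bool,
  has (stackable [:: 1; 2; 0; 2]%N [:: t2; t1; h; t3]) (permutations (iota 0 4))
  = (h + 1 == t1 + t2 + t3)%N.
Proof. by do 4!case; vm_compute. Qed.

(* The folded positions are 0, t, 3 t - pi, 4 t - pi, 3 t - pi, t. *)
Lemma stackable_waterbomb a b : (a, b) \in [:: (2, 1); (1, 1); (1, 2)]%N ->
  forall w2 w3 w4 w5 w6 w1 : bool,
  has (stackable [:: a; 3; 0; b; 0; 3]%N [:: w2; w3; w4; w5; w6; w1])
    (permutations (iota 0 6))
  = (w1 + w2 + w3 == w4 + w5 + w6)%N && (0 < w1 + w2 + w3 < 3)%N.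
Proof.
by rewrite !inE => /or3P[] /eqP[-> ->]; do 6!case; vm_compute.
Qed.

(** A sector that precedes some crease is never the one wrapping around the vertex, so the cyclic
    successor is a plain one. On a concrete list the sum then unfolds to a linear expression. *)
Lemma folded_positionE (R : realType) (s : seq (R * mv)) (i : 'I_(size s)) :
  folded_position i =
  \sum_(0 <= j < i) (-1) ^+ j * ((nth (0, false) s j.+1).1 - (nth (0, false) s j).1).
Proof.
pose F j := (-1) ^+ j * ((nth (0, false) s j.+1).1 - (nth (0, false) s j).1).
rewrite big_mkord (big_ord_widen _ F (ltnW (ltn_ord i))) {}/F.
apply: eq_bigr => j ji; have jk : (j.+1 < size s)%N by apply: leq_ltn_trans ji _.
by rewrite /sector_angle /crease_direction jk /= modn_small.
Qed.

(** Only the last sector passes direction 0, hence the separate term with [2 * pi]. *)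
Lemma sum_sector_angleE (R : realType) (x : R * mv) (s : seq (R * mv)) :
  \sum_(i < size (x :: s)) (-1) ^+ i * sector_angle i =
  \sum_(0 <= j < size s) (-1) ^+ j *
     ((nth (0, false) (x :: s) j.+1).1 - (nth (0, false) (x :: s) j).1)
  + (-1) ^+ size s * (x.1 + 2 * pi - (nth (0, false) (x :: s) (size s)).1).
Proof.
rewrite big_mkord big_ord_recr /=; congr (_ + _ * _).
- apply: eq_bigr => j _; rewrite /sector_angle /crease_direction /=.
  by rewrite ltnS ltn_ord modn_small// ltnS.
- by rewrite /sector_angle /crease_direction /= ltnn modnn.
Qed.

Lemma flat_foldableP (R : realType) (s : seq (R * mv)) (r : seq nat) :
  size r = size s ->
  (forall i j : 'I_(size s),
    (folded_position i < folded_position j) = (nth 0 r i < nth 0 r j)%N) ->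
  ~~ odd (size s) -> \sum_(i < size s) (-1) ^+ i * sector_angle i = 0 ->
  flat_foldable s
  <-> has (stackable r [seq x.2 | x <- s]) (permutations (iota 0 (size s))).
Proof.
move=> sr rk os s0; split=> [[_ _]|H]; first by move/(stackableP sr rk).
by split=> //; apply/(stackableP sr rk).
Qed.

(** The right-hand side is a closed comparison of ranks: conversion decides it, and a linear
    inequality between positions is left. *)
Ltac decide_lt :=
  match goal with |- ?b = _ =>
    first [change (is_true b) | change (b = false); apply/negbTE; rewrite -leNgt]
  end; lra.

(** With folds counted 1 and 0 instead of 1 and -1, the rule heel = sum of toes becomes 2h - 1 =
    2(t1 + t2 + t3) - 3, which is the equation below. *)
Lemma flat_foldable_foot_right (R : realType) (t : R) (h t1 t2 t3 : mv) :
  0 < t -> 2 * t < pi ->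
  flat_foldable [:: (0, h); (pi - t, t1); (pi, t2); (pi + t, t3)]
  <-> (h + 1 = t1 + t2 + t3)%N.
Proof.
move=> t0 tp; apply: iff_trans (_ : (h + 1 == t1 + t2 + t3)%N <-> _); last by split=> [/eqP|->].
rewrite -stackable_foot_right; apply: flat_foldableP => //.
- by case=> [[|[|[|[|?]]]] ?] [[|[|[|[|?]]]] ?] //;
    rewrite !folded_positionE unlock /=;
    decide_lt.
- by rewrite sum_sector_angleE unlock /=; lra.
Qed.

Lemma flat_foldable_foot_left (R : realType) (t : R) (h t1 t2 t3 : mv) :
  0 < t -> 2 * t < pi ->
  flat_foldable [:: (0, t2); (t, t1); (pi, h); (2 * pi - t, t3)]
  <-> (h + 1 = t1 + t2 + t3)%N.
Proof.
move=> t0 tp; apply: iff_trans (_ : (h + 1 == t1 + t2 + t3)%N <-> _); last by split=> [/eqP|->].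
rewrite -stackable_foot_left; apply: flat_foldableP => //.
- by case=> [[|[|[|[|?]]]] ?] [[|[|[|[|?]]]] ?] //;
    rewrite !folded_positionE unlock /=;
    decide_lt.
- by rewrite sum_sector_angleE unlock /=; lra.
Qed.

(** Two signed sums equal to 1 or -1 add up to 2 or -2 exactly when they are equal. In 0/1 counts
    the two triples have the same number of mountains, 1 or 2. *)
Lemma flat_foldable_waterbomb (R : realType) (t : R) (w1 w2 w3 w4 w5 w6 : mv) :
  0 < t -> t < pi - 2 * t ->
  flat_foldable [:: (0, w2); (t, w3); (pi - t, w4); (pi, w5); (pi + t, w6);
    (2 * pi - t, w1)]
  <-> (w1 + w2 + w3 = w4 + w5 + w6)%N /\ (0 < w1 + w2 + w3 < 3)%N.
Proof.
move=> t0 tp.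
apply: iff_trans (_ : (w1 + w2 + w3 == w4 + w5 + w6)%N && (0 < w1 + w2 + w3 < 3)%N <-> _); last first.
  by split=> [/andP[/eqP]//|[/eqP]->].
(* The comparison of the positions of the creases 0 and 3 depends on [t]. *)
have [tq|tq|tq] := ltrgtP (4 * t) pi;
  [rewrite -(@stackable_waterbomb 2 1)//|rewrite -(@stackable_waterbomb 1 2)//
  |rewrite -(@stackable_waterbomb 1 1)//]; apply: flat_foldableP => //.
all: try by rewrite sum_sector_angleE unlock /=; lra.
all: case=> [[|[|[|[|[|[|?]]]]]] ?] [[|[|[|[|[|[|?]]]]]] ?] //.
all: rewrite !folded_positionE unlock /=.
all: by decide_lt.
Qed.

(** * Directions of the creases *)

Lemma direction_east (R : realType) (x : R) : 0 < x -> direction (x, 0) = 0.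
Proof.
move=> x0; rewrite /direction /= lexx expr0n /= addr0 sqrtr_sqr gtr0_norm//.
by rewrite divff ?acos1// gt_eqF.
Qed.

Lemma direction_west (R : realType) (x : R) : x < 0 -> direction (x, 0) = pi.
Proof.
move=> x0; rewrite /direction /= lexx expr0n /= addr0 sqrtr_sqr ltr0_norm//.
by rewrite invrN mulrN divff ?acosN1// lt_eqF.
Qed.

Section AcuteDirection.
Variables (R : realType) (d : R).
Hypothesis d0 : 0 < d.

Let c := d / Num.sqrt (d ^+ 2 + 1).

Lemma cos_acute_bounds : 0 < c < 1.
Proof.
have d2 : 0 < d ^+ 2 by rewrite exprn_gt0.
have s0 : 0 < Num.sqrt (d ^+ 2 + 1) by rewrite sqrtr_gt0; lra.
rewrite divr_gt0//= ltr_pdivrMr// mul1r -{1}(gtr0_norm d0) -sqrtr_sqr.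
by rewrite ltr_sqrt; lra.
Qed.

Lemma direction_acute_bounds : 0 < direction (d, 1) < pi / 2.
Proof.
have /andP[c0 c1] := cos_acute_bounds.
rewrite /direction /= ler01 expr1n -/c acos_gt0; last by apply/andP; split; lra.
have c11 : c \in `[(-1), 1] by rewrite in_itv/=; apply/andP; split; lra.
rewrite -ltr_cos ?in_itv/=.
- by rewrite acosK// cos_pihalf.
- by rewrite acos_ge0 ?acos_lepi//; move: c11; rewrite in_itv.
- by have := pi_gt0 R; lra.
Qed.

Lemma direction_north_west : direction (- d, 1) = pi - direction (d, 1).
Proof.
have /andP[c0 c1] := cos_acute_bounds.
rewrite /direction /= ler01 sqrrN expr1n mulNr -/c acosN//.
by apply/andP; split; lra.
Qed.

Lemma direction_south_east : direction (d, - 1) = 2 * pi - direction (d, 1).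
Proof. by rewrite /direction /= ler01 oppr_ge0 ler10 sqrrN. Qed.

Lemma direction_south_west : direction (- d, - 1) = pi + direction (d, 1).
Proof.
transitivity (2 * pi - direction (- d, 1)); last first.
  by rewrite direction_north_west; ring.
by rewrite /direction /= ler01 oppr_ge0 ler10 !sqrrN.
Qed.

End AcuteDirection.

(** This is [direction_from] on bare pieces, which avoids the subset type [crease]. *)
Definition piece_direction (R : realType) (m n : nat) (L : zigzag_pattern R m n)
    (v : R * R) (p : piece m n) : R :=
  let e := endpoints L p in
  let w := if v == e.1 then e.2 else e.1 in
  direction (w.1 - v.1, w.2 - v.2).

Lemma uniq_map_inj (T1 T2 : eqType) (f : T1 -> T2) (s : seq T1) :
  uniq (map f s) -> {in s &, injective f}.
Proof.
elim: s => //= x s IH /andP[xs us] y z.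
rewrite !inE => /predU1P[->|ys] /predU1P[->|zs] // e; last exact: IH.
- by rewrite e map_f in xs.
- by rewrite -e map_f in xs.
Qed.

(** A sorted list is determined by its elements once the order is antisymmetric on them. The strict
    increase of the directions along [ps] gives this, so it suffices to exhibit the pieces in
    counterclockwise order. *)
Lemma creases_atE (R : realType) (m n : nat) (L : zigzag_pattern R m n)
    (mu : {ffun crease L -> mv}) (w : piece m n -> mv) (v : R * R)
    (ps : seq (piece m n)) :
  (forall c, mu c = w (val c)) ->
  (forall p, (p \in ps) = ((endpoints L p).1 != (endpoints L p).2)
     && ((v == (endpoints L p).1) || (v == (endpoints L p).2))) ->
  sorted <%R [seq piece_direction L v p | p <- ps] ->
  [seq (direction_from v c, mu c) | c <- creases_at L v] =
  [seq (piece_direction L v p, w p) | p <- ps].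
Proof.
move=> muE psE srt.
suff <- : [seq val c | c <- creases_at L v] = ps.
  by rewrite -map_comp; apply: eq_map => c /=; rewrite muE.
have ups : uniq [seq piece_direction L v p | p <- ps].
  exact: lt_sorted_uniq.
have in_ps c : c \in creases_at L v -> val c \in ps.
  rewrite mem_sort mem_enum psE => ?; apply/andP; split => //; exact: (valP c).
pose leT := relpre (piece_direction L v) (@Order.le _ R).
apply: (@sorted_eq_in _ leT).
- by move=> x y z _ _ _; exact: le_trans.
- move=> p q /mapP[c cv ->] /mapP[c' cv' ->] /le_anti.
  by apply: (uniq_map_inj ups); exact: in_ps.
- rewrite sorted_map; apply: sort_sorted => c c'; exact: le_total.
- by rewrite -sorted_map; apply: sub_sorted srt => x y /ltW.
- apply: uniq_perm.
  + rewrite (map_inj_uniq val_inj) sort_uniq; exact: enum_uniq.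
  + exact: map_uniq ups.
  + move=> p; apply/mapP/idP => [[c cv ->]|]; first exact: in_ps.
    rewrite psE => /andP[np vp]; exists (Sub p np : crease L).
      by rewrite mem_sort mem_enum.
    by [].
Qed.

(** * Order and coincidences of the columns in a row *)

Section Grid.
Variables (R : realType) (m n : nat) (L : zigzag_pattern R m.+1 n.+1).
Hypothesis snakeL : snake_tessellation L.

Definition column (i j : nat) : R := (grid_point L i j).1.

(* [turn i j] says that epsilon_j (-1)^i = -1, in which case the heel of the
   bird's foot (i, j) points to the left. *)
Definition turn (i j : nat) : bool := odd i (+) reflected L j.

Lemma grid_pointE i j : grid_point L i j = (column i j, i%:R).
Proof. by rewrite /column /grid_point; case: ifP => //; case: ifP. Qed.

Lemma eq_grid_point i j i' j' :
  (grid_point L i j == grid_point L i' j') =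
  (i == i') && (column i j == column i' j').
Proof. by rewrite !grid_pointE xpair_eqE eqr_nat andbC. Qed.

Lemma delta_gt0 : 0 < delta L.
Proof. by case: snakeL => -[]. Qed.

Lemma grid_point_zigzag i j : (0 < j < n.+1)%N ->
  grid_point L i j = zigzag_point L i j.
Proof. by case/andP=> j0 jn; rewrite /grid_point gtn_eqF// ltn_eqF. Qed.

Lemma column_zigzag i j : (0 < j < n.+1)%N ->
  column i j = abscissa L j + (-1) ^+ turn i j * delta L.
Proof.
move=> jn; rewrite /column grid_point_zigzag//=.
by rewrite /turn addbC signr_addb signr_odd.
Qed.

Lemma disjoint_zigzag_gap j : (0 < j)%N -> (j.+1 < n.+1)%N ->
  (zigzag L j `&` zigzag L j.+1 = set0)%classic ->
  reflected L j.+1 = ~~ reflected L j ->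
  2 * delta L < abscissa L j.+1 - abscissa L j.
Proof.
move=> j0 jn disj refl.
have d0 := delta_gt0.
have abs_lt : abscissa L j < abscissa L j.+1.
  by case: snakeL => -[_ _ + _] _ _; apply.
rewrite ltNge; apply/negP => gap.
(* The two zig-zags would cross between the lines y = 0 and y = 1. *)
pose g := (abscissa L j.+1 - abscissa L j) / (4 * delta L).
have gE : abscissa L j.+1 - abscissa L j = g * (4 * delta L).
  by rewrite /g divfK// gt_eqF//; lra.
have g0 : 0 < g by rewrite divr_gt0//; lra.
have g1 : g <= 2^-1 by rewrite ler_pdivrMr; lra.
(* At height t of the first strip the zig-zags are at signed distance gap + 2 delta (1 - 2t) if
   zig-zag j is reflected, and gap - 2 delta (1 - 2t) otherwise. This [t] is the zero. *)
pose t := if reflected L j then 2^-1 + g else 2^-1 - g.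
have t01 : 0 <= t <= 1 by rewrite /t; case: ifP => _; apply/andP; split; lra.
suff : (set0 : set (R * R))
  ((1 - t) * (zigzag_point L 0 j).1 + t * (zigzag_point L 1 j).1, t) by [].
rewrite -disj; split; exists 0%N, t; split=> //; congr (_, _).
- by rewrite /zigzag_point /=; ring.
- rewrite /zigzag_point /= refl /t; case: (reflected L j); rewrite /= ?expr0 ?expr1; nra.
- by rewrite /zigzag_point /=; ring.
Qed.

(** Equal signs shift both columns alike. Opposite signs change the gap by 2 delta either way: a gap
    above 2 delta stays positive, while a gap of exactly 2 delta becomes 0 or 4 delta according to
    the row. It becomes 0 only where the two heels face each other. *)
Lemma column_step i j : (i <= m.+1)%N -> (j <= n)%N ->
  column i j < column i j.+1 \/
  [/\ (0 < j < n)%N, column i j = column i j.+1, ~~ turn i j & turn i j.+1].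
Proof.
move=> im jn.
have [[_ lr abs_lt inside] sep _] := snakeL.
have d0 := delta_gt0.
have [->|j0] := posnP j.
  left; rewrite /column /grid_point /=; case: ifP => [_ //|n1].
  by case/andP: (inside i 1%N im ltac:(lia)).
have [jE|jn'] := eqVneq j n.
  left; rewrite /column /grid_point jE eqxx /= gtn_eqF ?ltn_eqF//; last by lia.
  by case/andP: (inside i n im ltac:(lia)).
have {jn'} jn1 : (j < n)%N by lia.
have jlt := abs_lt j j.+1 j0 (leqnn _) jn1.
rewrite !column_zigzag; try lia.
have tE : turn i j.+1 = turn i j (+) (reflected L j != reflected L j.+1).
  by rewrite /turn; case: (odd i); case: (reflected L j); case: (reflected L j.+1).
have [re|nre] := eqVneq (reflected L j) (reflected L j.+1).
  by left; rewrite tE re eqxx addbF ltrD2r.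
have refl : reflected L j.+1 = ~~ reflected L j.
  by move: nre; case: (reflected L j); case: (reflected L j.+1).
rewrite tE nre addbT.
have [disj|[_ _ gap]] := sep j j.+1 j0 (leqnn _) jn1.
  have gap := disjoint_zigzag_gap j0 jn1 disj refl.
  by left; case: (turn i j); rewrite /= expr0 expr1; lra.
case: (turn i j); rewrite /= expr0 expr1; [left; lra|right; split; rewrite ?j0 //; lra].
Qed.

Lemma column_le i j k : (i <= m.+1)%N -> (j <= k)%N -> (k <= n.+1)%N ->
  column i j <= column i k.
Proof.
move=> im; elim: k => [|k IH]; first by rewrite leqn0 => /eqP->.
rewrite leq_eqVlt ltnS => /predU1P[-> //|jk] kn.
apply: (le_trans (IH jk (ltnW kn))).
by case: (column_step im kn) => [/ltW//|[_ ->]].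
Qed.

(** Two successive coincidences would require the middle foot to have its heel on both sides.
    Vertices therefore merge at most in pairs. *)
Lemma column_lt2 i j : (i <= m.+1)%N -> (j.+1 <= n)%N ->
  column i j < column i j.+2.
Proof.
move=> im jn.
case: (column_step im (ltnW jn)) => [lt|[_ _ _ t]].
  by apply: lt_le_trans lt _; apply: column_le => //; lia.
case: (column_step im jn) => [lt|[_ _ nt]]; last by rewrite t in nt.
by apply: le_lt_trans lt; apply: column_le => //; lia.
Qed.

Lemma column_eq i j k : (i <= m.+1)%N -> (j < k)%N -> (k <= n.+1)%N ->
  column i j = column i k -> k = j.+1.
Proof.
move=> im jk kn e; apply/eqP; rewrite eqn_leq jk andbT leqNgt; apply/negP => jk2.
have := lt_le_trans (column_lt2 im (leq_trans jk2 kn)) (column_le im jk2 kn).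
by rewrite e ltxx.
Qed.

End Grid.

(** * Pieces around a vertex and contracted heels *)

Section Vertex.
Variables (R : realType) (m n : nat) (L : zigzag_pattern R m.+1 n.+1).
Hypothesis snakeL : snake_tessellation L.

Local Notation X := (column L).
Local Notation piece := (piece m.+1 n.+1).

(** The indices start at 0, so [(i, j)] denotes the interior vertex in row i + 1 and column j + 1.
    The piece between two neighbours has two names, [east] of the left one and [west] of the right
    one. *)
Definition east (i : 'I_m) (j : 'I_n) : piece := inl (i, lift ord0 j).
Definition west (i : 'I_m) (j : 'I_n) : piece := inl (i, widen_ord (leqnSn n) j).
Definition north (i : 'I_m) (j : 'I_n) : piece := inr (lift ord0 i, j).
Definition south (i : 'I_m) (j : 'I_n) : piece := inr (widen_ord (leqnSn m) i, j).

Definition vertex (i : 'I_m) (j : 'I_n) : R * R := grid_point L i.+1 j.+1.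

Definition degenerate (p : piece) : bool :=
  (endpoints L p).1 == (endpoints L p).2.

Lemma endpoints_inl (a : 'I_m) (b : 'I_n.+1) :
  endpoints L (inl (a, b) : piece) = (grid_point L a.+1 b, grid_point L a.+1 b.+1).
Proof. by []. Qed.

Lemma endpoints_inr (a : 'I_m.+1) (b : 'I_n) :
  endpoints L (inr (a, b) : piece) = (grid_point L a b.+1, grid_point L a.+1 b.+1).
Proof. by []. Qed.

Lemma degenerate_inl (a : 'I_m) (b : 'I_n.+1) :
  degenerate (inl (a, b)) = (X a.+1 b == X a.+1 b.+1).
Proof. by rewrite /degenerate endpoints_inl eq_grid_point eqxx. Qed.

Lemma degenerate_inr (a : 'I_m.+1) (b : 'I_n) : degenerate (inr (a, b)) = false.
Proof. by rewrite /degenerate endpoints_inr eq_grid_point ltn_eqF. Qed.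

Lemma degenerate_east (i : 'I_m) (j : 'I_n) :
  degenerate (east i j) = (X i.+1 j.+1 == X i.+1 j.+2).
Proof. by rewrite degenerate_inl lift0. Qed.

Lemma degenerate_west (i : 'I_m) (j : 'I_n) :
  degenerate (west i j) = (X i.+1 j == X i.+1 j.+1).
Proof. by rewrite degenerate_inl. Qed.

Lemma piece_direction_east (i : 'I_m) (j : 'I_n) : ~~ degenerate (east i j) ->
  piece_direction L (vertex i j) (east i j) = 0.
Proof.
rewrite degenerate_east => nd.
rewrite /piece_direction endpoints_inl lift0 /= /vertex eqxx !grid_pointE /= subrr.
rewrite direction_east// subr_gt0 lt_neqAle nd/= (column_le snakeL) //.
all: have := ltn_ord i; have := ltn_ord j; lia.
Qed.

Lemma piece_direction_west (i : 'I_m) (j : 'I_n) : ~~ degenerate (west i j) ->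
  piece_direction L (vertex i j) (west i j) = pi.
Proof.
rewrite degenerate_west => nd.
rewrite /piece_direction endpoints_inl /= /vertex eq_grid_point eqxx /= eq_sym.
rewrite (negbTE nd) !grid_pointE /= subrr.
rewrite direction_west// subr_lt0 lt_neqAle nd/= (column_le snakeL) //.
all: have := ltn_ord i; have := ltn_ord j; lia.
Qed.

(** Along a zig-zag both adjacent rows are displaced to the side opposite to this one, so the
    horizontal step is 2 delta, to the right exactly when [turn] holds. The same holds for
    [south]. *)
Lemma piece_direction_north (i : 'I_m) (j : 'I_n) :
  piece_direction L (vertex i j) (north i j) =
  if turn L i.+1 j.+1 then theta L else pi - theta L.
Proof.
have d0 : 0 < 2 * delta L by have := delta_gt0 snakeL; lra.
rewrite /piece_direction endpoints_inr lift0 /= /vertex eqxx !grid_pointE /=.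
rewrite !column_zigzag ?ltnS ?ltn_ord// (_ : _ - _ = (-1) ^+ (~~ turn L i.+1 j.+1) * (2 * delta L)).
  rewrite (_ : i.+2%:R - i.+1%:R = 1 :> R); last by rewrite -natrB ?subSnn.
  case: (turn L i.+1 j.+1); rewrite /= ?expr0 ?expr1 ?mul1r ?mulN1r //.
  exact: direction_north_west.
rewrite /turn /= negbK; case: (odd i); case: (reflected L j.+1) => /=; rewrite ?expr0 ?expr1; ring.
Qed.

Lemma piece_direction_south (i : 'I_m) (j : 'I_n) :
  piece_direction L (vertex i j) (south i j) =
  if turn L i.+1 j.+1 then 2 * pi - theta L else pi + theta L.
Proof.
have d0 : 0 < 2 * delta L by have := delta_gt0 snakeL; lra.
rewrite /piece_direction endpoints_inr /= /vertex eq_grid_point gtn_eqF //= !grid_pointE /=.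
rewrite !column_zigzag ?ltnS ?ltn_ord// (_ : _ - _ = (-1) ^+ (~~ turn L i.+1 j.+1) * (2 * delta L)).
  rewrite (_ : i%:R - i.+1%:R = -1 :> R); last by rewrite -opprB -natrB ?subSnn.
  case: (turn L i.+1 j.+1); rewrite /= ?expr0 ?expr1 ?mul1r ?mulN1r //.
  - exact: direction_south_east.
  - exact: direction_south_west.
rewrite /turn /=; case: (odd i); case: (reflected L j.+1) => /=; rewrite ?expr0 ?expr1; ring.
Qed.

Lemma theta_bounds : 0 < theta L < pi / 2.
Proof. by apply: direction_acute_bounds; have := delta_gt0 snakeL; lra. Qed.

(** A contracted piece is the heel of both feet at its ends: it lies to the right of the left foot
    and to the left of the right one. *)
Lemma degenerate_east_turn (i : 'I_m) (j : 'I_n) : degenerate (east i j) ->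
  exists j2 : 'I_n, [/\ j2 = j.+1 :> nat, east i j = west i j2,
    ~~ turn L i.+1 j.+1 & turn L i.+1 j2.+1].
Proof.
rewrite degenerate_east => /eqP e.
have [|[jn _ t t2]] := column_step snakeL (i := i.+1) (j := j.+1) (ltnW (ltn_ord i)) (ltn_ord j).
  by rewrite e ltxx.
exists (Ordinal jn); split => //; rewrite /east /west; congr (inl (_, _)).
exact: val_inj.
Qed.

Lemma degenerate_west_turn (i : 'I_m) (j : 'I_n) : degenerate (west i j) ->
  exists j1 : 'I_n, [/\ j = j1.+1 :> nat, east i j1 = west i j & turn L i.+1 j.+1].
Proof.
rewrite degenerate_west => /eqP e.
have [|[/andP[j0 jn] _ t t2]] := column_step snakeL (i := i.+1) (j := j) (ltnW (ltn_ord i)) (ltnW (ltn_ord j)).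
  by rewrite e ltxx.
have j1n : (j.-1 < n)%N by lia.
exists (Ordinal j1n); split=> //; first by rewrite prednK.
rewrite /east /west; congr (inl (_, _)).
by apply: val_inj; rewrite /= /bump leq0n add1n prednK.
Qed.

Lemma degenerate_east_west (i : 'I_m) (j : 'I_n) :
  degenerate (east i j) -> ~~ degenerate (west i j).
Proof.
move=> /degenerate_east_turn[j2 [_ _ nt _]].
by apply/negP => /degenerate_west_turn[j1 [_ _]]; rewrite (negbTE nt).
Qed.

(** Zig-zag pieces join different rows, and a piece leaving the left edge has positive length. *)
Lemma degenerate_is_east (p : piece) : degenerate p -> exists i j, p = east i j.
Proof.
case: p => [[a b]|[a b]]; last by rewrite degenerate_inr.
case: (unliftP ord0 b) => [j ->|->]; first by exists a, j.
rewrite degenerate_inl => /eqP e.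
have [|[]//] := column_step snakeL (i := a.+1) (j := 0) (ltnW (ltn_ord a)) (leq0n n).
by rewrite [X in X < _]e ltxx.
Qed.

Lemma vertex_waterbomb (i : 'I_m) (j j2 : 'I_n) :
  degenerate (east i j) -> j2 = j.+1 :> nat -> vertex i j = vertex i j2.
Proof.
rewrite degenerate_east => dE j2E.
by apply/eqP; rewrite /vertex eq_grid_point eqxx /= j2E.
Qed.

Lemma eq_inl_piece (a c : 'I_m) (b d : 'I_n.+1) :
  (inl (a, b) == inl (c, d) :> piece) = (a == c :> nat) && (b == d :> nat).
Proof. by []. Qed.

Lemma eq_inr_piece (a c : 'I_m.+1) (b d : 'I_n) :
  (inr (a, b) == inr (c, d) :> piece) = (a == c :> nat) && (b == d :> nat).
Proof. by []. Qed.

Definition meets (v : R * R) (p : piece) : bool :=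
  (v == (endpoints L p).1) || (v == (endpoints L p).2).

Lemma meets_inl (i : 'I_m) (j : 'I_n) (a : 'I_m) (b : 'I_n.+1) :
  meets (vertex i j) (inl (a, b)) =
  (a == i :> nat) && ((X i.+1 j.+1 == X i.+1 b) || (X i.+1 j.+1 == X i.+1 b.+1)).
Proof.
rewrite /meets endpoints_inl /vertex !eq_grid_point eqSS eq_sym.
by case: eqP => // ->.
Qed.

Lemma meets_inr (i : 'I_m) (j : 'I_n) (a : 'I_m.+1) (b : 'I_n) :
  meets (vertex i j) (inr (a, b)) =
  ((a == i.+1 :> nat) || (a == i :> nat)) && (X i.+1 j.+1 == X i.+1 b.+1).
Proof.
rewrite /meets endpoints_inr /vertex !eq_grid_point eqSS andb_orl.
rewrite (eq_sym i.+1) (eq_sym (i : nat)).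
by congr orb; [case: (eqVneq (a : nat) i.+1) => [->|]|case: (eqVneq (a : nat) i) => [->|]].
Qed.

Lemma foot_creases (i : 'I_m) (j : 'I_n) (p : piece) :
  ~~ degenerate (east i j) -> ~~ degenerate (west i j) ->
  (p \in [:: east i j; north i j; west i j; south i j]) =
  ~~ degenerate p && meets (vertex i j) p.
Proof.
rewrite degenerate_east degenerate_west => ndE ndW.
have im : (i.+1 <= m.+1)%N by rewrite ltnW// ltnS.
(* By [column_eq] another column at this abscissa would be a neighbour, and then one of the
   horizontal pieces would be contracted. *)
have XE k : (k <= n.+1)%N -> (X i.+1 j.+1 == X i.+1 k) = (k == j.+1).
  move=> kn; apply/eqP/eqP => [|-> //].
  case: (ltngtP k j.+1) => // kj e.
  - have kE := column_eq snakeL im kj (leqW (ltn_ord j)) (esym e).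
    by case: kE => kE; rewrite e -kE eqxx in ndW.
  - have kE := column_eq snakeL im kj kn e.
    by rewrite e kE eqxx in ndE.
case: p => [[a b]|[a b]]; rewrite !inE.
- rewrite /= !eq_inl_piece lift0 /= degenerate_inl meets_inl !XE ?ltn_ord//; last exact: ltnW.
  case: (eqVneq (a : nat) i) => [->|_]; rewrite /= ?andbF //.
  rewrite orbF; case: (eqVneq (b : nat) j.+1) => [->|_]; first by rewrite ndE.
  by case: (eqVneq (b : nat) j) => [->|/negbTE bj]; rewrite ?ndW ?eqSS ?eqxx ?bj ?andbF.
- rewrite /= !eq_inr_piece lift0 /= degenerate_inr meets_inr XE ?(leqW (ltn_ord b))// eqSS.
  by rewrite -andb_orl.
Qed.

Lemma waterbomb_creases (i : 'I_m) (j j2 : 'I_n) (p : piece) :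
  degenerate (east i j) -> j2 = j.+1 :> nat ->
  (p \in [:: east i j2; north i j2; north i j; west i j; south i j; south i j2]) =
  ~~ degenerate p && meets (vertex i j) p.
Proof.
rewrite degenerate_east => /eqP dE j2E.
have jn : (j.+1 < n)%N by rewrite -j2E.
have im : (i.+1 <= m.+1)%N by rewrite ltnW// ltnS.
have ltW : X i.+1 j < X i.+1 j.+1 by rewrite dE (column_lt2 snakeL)// ltnW.
have ltE : X i.+1 j.+2 < X i.+1 j.+3 by rewrite -dE (column_lt2 snakeL).
(* The merged vertex lies on exactly two columns, as merging stops at pairs. *)
have XE k : (k <= n.+1)%N -> (X i.+1 j.+1 == X i.+1 k) = (k == j.+1) || (k == j.+2).
  move=> kn; apply/eqP/orP => [|[/eqP->|/eqP->]//].
  case: (ltngtP k j.+1) => // [kj e|kj e|-> _]; last by left.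
  - have kE := column_eq snakeL im kj (leqW (ltn_ord j)) (esym e).
    by case: kE => kE; rewrite e -kE ltxx in ltW.
  - by right; rewrite (column_eq snakeL im kj kn e).
case: p => [[a b]|[a b]]; rewrite !inE.
- rewrite /= !eq_inl_piece lift0 /= degenerate_inl meets_inl !XE ?ltn_ord//; last exact: ltnW.
  case: (eqVneq (a : nat) i) => [->|_]; rewrite /= ?andbF //.
  rewrite orbF j2E.
  have [->|_] := eqVneq (b : nat) j.+2; first by rewrite (lt_eqF ltE) /= orbT.
  have [->|/negbTE bj1] := eqVneq (b : nat) j.+1; first by rewrite dE eqxx (gtn_eqF (leqnn _)).
  by have [->|/negbTE bj] := eqVneq (b : nat) j;
    rewrite ?(lt_eqF ltW) ?eqSS ?eqxx ?orbT ?bj ?bj1 ?andbF.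
- rewrite /= !eq_inr_piece lift0 /= degenerate_inr meets_inr XE ?(leqW (ltn_ord b))// !eqSS ?orbF j2E.
  by case: (a == i.+1 :> nat); case: (a == i :> nat); case: (b == j :> nat);
    case: (b == j.+1 :> nat).
Qed.

(** * Twisted assignments and the ice rule *)

(* The change of variables mu(c) |-> epsilon_j (-1)^i mu(c) on the zig-zags. *)
Definition twist (p : piece) : bool :=
  if p is inr (a, b) then turn L a b.+1 else false.
Arguments twist : simpl never.

(** Multiplication of signs is [(+)] on booleans, and [twist] is its own inverse. The values of [w]
    on contracted heels are forgotten. *)
Definition untwisted (w : piece -> mv) : {ffun crease L -> mv} :=
  [ffun c => w (val c) (+) twist (val c)].

Definition foldable_at (mu : {ffun crease L -> mv}) (i : 'I_m) (j : 'I_n) : Prop :=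
  flat_foldable
    [seq (direction_from (vertex i j) c, mu c) | c <- creases_at L (vertex i j)].

Lemma twist_north (i : 'I_m) (j : 'I_n) : twist (north i j) = turn L i.+1 j.+1.
Proof. by rewrite /twist /north lift0. Qed.

Lemma twist_south (i : 'I_m) (j : 'I_n) : twist (south i j) = ~~ turn L i.+1 j.+1.
Proof. by rewrite /twist /south /turn /= addNb negbK. Qed.

(** The twist complements exactly one of the two zig-zag toes. Counted as 1 - x, it moves to the
    other side of the foot rule and cancels the 1 there, for both orientations of the foot. *)
Lemma foldable_at_foot (w : piece -> mv) (i : 'I_m) (j : 'I_n) :
  ~~ degenerate (east i j) -> ~~ degenerate (west i j) ->
  foldable_at (untwisted w) i j <->
  (w (east i j) + w (south i j) = w (west i j) + w (north i j))%N.
Proof.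
move=> ndE ndW; have /andP[t0 t1] := theta_bounds.
rewrite /foldable_at (@creases_atE _ _ _ _ _ (fun p => w p (+) twist p) _
  [:: east i j; north i j; west i j; south i j]).
- rewrite /= piece_direction_east// piece_direction_west//.
  rewrite piece_direction_north piece_direction_south twist_north twist_south !addbF.
  case: (turn L i.+1 j.+1); rewrite !(addbT, addbF).
  + apply: iff_trans (flat_foldable_foot_left _ _ _ _ t0 _) _; first by lra.
    by do 4 case: (w _).
  + apply: iff_trans (flat_foldable_foot_right _ _ _ _ t0 _) _; first by lra.
    by do 4 case: (w _).
- by move=> c; rewrite ffunE.
- by move=> p; rewrite foot_creases.
- rewrite /= piece_direction_east// piece_direction_west//.
  rewrite piece_direction_north piece_direction_south.
  by case: (turn L i.+1 j.+1); rewrite andbT; apply/and3P; split; lra.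
Qed.

Lemma theta_waterbomb (i : 'I_m) (j j2 : 'I_n) :
  degenerate (east i j) -> j2 = j.+1 :> nat -> theta L < pi - 2 * theta L.
Proof.
rewrite degenerate_east => /eqP e j2E.
have jn : (j.+2 < n.+1)%N by rewrite ltnS -j2E.
have [_ _ /(_ i.+1 j.+1)] := snakeL; apply=> //; first by rewrite !ltnS ltn_ord.
by apply/eqP; rewrite -!grid_point_zigzag ?jn ?ltnS ?ltn_ord// eq_grid_point eqxx e eqxx.
Qed.

(** Here [h] is the fold of the contracted heel, and the two equations are the foot rules at the two
    merged feet. *)
Lemma foldable_at_waterbomb (w : piece -> mv) (i : 'I_m) (j j2 : 'I_n) :
  degenerate (east i j) -> j2 = j.+1 :> nat ->
  foldable_at (untwisted w) i j <->
  exists h : bool, (h + w (south i j) = w (west i j) + w (north i j))%N /\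
    (w (east i j2) + w (south i j2) = h + w (north i j2))%N.
Proof.
move=> dE j2E; have /andP[t0 t1] := theta_bounds.
have t3 := theta_waterbomb dE j2E.
have vE := vertex_waterbomb dE j2E.
have dW : degenerate (west i j2) by rewrite degenerate_west j2E -degenerate_east.
have [j3 [j3E _ nt tu]] := degenerate_east_turn dE.
have {}tu : turn L i.+1 j2.+1 by rewrite j2E -j3E.
have ndE : ~~ degenerate (east i j2).
  by apply/negP => /degenerate_east_turn[j4 [_ _]]; rewrite tu.
have ndW := degenerate_east_west dE.
have dirs : [/\ piece_direction L (vertex i j) (east i j2) = 0,
    piece_direction L (vertex i j) (north i j2) = theta L
  & piece_direction L (vertex i j) (south i j2) = 2 * pi - theta L].
  by rewrite vE piece_direction_east// piece_direction_north piece_direction_south tu.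
have [dirE dirN dirS] := dirs.
rewrite /foldable_at (@creases_atE _ _ _ _ _ (fun p => w p (+) twist p) _
  [:: east i j2; north i j2; north i j; west i j; south i j; south i j2]).
- rewrite /= dirE dirN dirS piece_direction_west//.
  rewrite piece_direction_north piece_direction_south (negbTE nt) !twist_north !twist_south.
  rewrite tu (negbTE nt) !(addbT, addbF).
  apply: iff_trans (flat_foldable_waterbomb _ _ _ _ _ _ t0 t3) _.
  split=> [[H1 H2]|[h]]; last by case: h => -[]; do 6 case: (w _).
  (* The left foot demands h + 1 = sum of its toes, a sum known to be 1 or 2; its south toe is the
     complemented one. *)
  exists (1 < w (west i j) + w (north i j) + ~~ w (south i j))%N; move: H1 H2.
  by do 6 case: (w _).
- by move=> c; rewrite ffunE.
- by move=> p; rewrite waterbomb_creases.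
- rewrite /= dirE dirN dirS piece_direction_west//.
  rewrite piece_direction_north piece_direction_south (negbTE nt) andbT.
  by apply/and5P; split; lra.
Qed.

(** This is the six-vertex model: point a horizontal piece east and a vertical one south when its
    value is true, and the other way otherwise; then two pieces enter the vertex and two leave
    it. *)
Definition ice_rule (w : piece -> mv) (i : 'I_m) (j : 'I_n) : bool :=
  (w (east i j) + w (south i j) == w (west i j) + w (north i j))%N.

Definition ice_configurations : {set {ffun piece -> mv}} :=
  [set w : {ffun piece -> mv} | [forall i, forall j, ice_rule w i j]]%SET.

Lemma ice_configurationsP (w : {ffun piece -> mv}) :
  reflect (forall i j, ice_rule w i j) (w \in ice_configurations).
Proof.
rewrite inE; apply: (iffP forallP) => [H i j|H i]; last exact/forallP.
by have /forallP := H i; apply.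
Qed.

Lemma locally_validE (mu : {ffun crease L -> mv}) :
  locally_valid mu <-> forall i j, foldable_at mu i j.
Proof.
split=> [H i j|H [|i] [|j]//]; first by apply: (H i.+1 j.+1); rewrite !ltnS ltn_ord.
rewrite /= !ltnS => im jn.
by have := H (Ordinal im) (Ordinal jn).
Qed.

Lemma ice_foldable_at (w : piece -> mv) :
  (forall i j, ice_rule w i j) -> forall i j, foldable_at (untwisted w) i j.
Proof.
move=> ice i j.
(* A merged vertex has two index pairs; it is treated at its left foot, and the right one is
   transported by [vertex_waterbomb]. *)
have bomb k (k2 : 'I_n) : degenerate (east i k) -> k2 = k.+1 :> nat -> east i k = west i k2 ->
    foldable_at (untwisted w) i k.
  move=> dE kE eE; apply/(foldable_at_waterbomb w dE kE).
  by exists (w (east i k)); rewrite {2}eE; split; apply/eqP/ice.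
have [dE|ndE] := boolP (degenerate (east i j)).
  by have [j2 [j2E eE _ _]] := degenerate_east_turn dE; exact: bomb j2E eE.
have [dW|ndW] := boolP (degenerate (west i j)); last exact/foldable_at_foot/eqP/ice.
have [j1 [jE eE _]] := degenerate_west_turn dW.
have dE : degenerate (east i j1) by rewrite eE.
by rewrite /foldable_at -(vertex_waterbomb dE jE); exact: bomb jE eE.
Qed.

(** Only the values on contracted heels are lost, and the ice rule at the left foot recovers each of
    them from three genuine creases. *)
Lemma untwisted_inj : {in ice_configurations &, injective (fun w : {ffun piece -> mv} => untwisted w)}.
Proof.
move=> w1 w2 /ice_configurationsP ice1 /ice_configurationsP ice2 e.
have nd p : ~~ degenerate p -> w1 p = w2 p.
  move=> ndp; have /ffunP/(_ (Sub p ndp : crease L)) := e.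
  by rewrite !ffunE /= => /addIb.
apply/ffunP => p; have [dp|] := boolP (degenerate p); last exact: nd.
have [i [j pE]] := degenerate_is_east dp; rewrite pE in dp *.
move: (ice1 i j) (ice2 i j); rewrite /ice_rule.
rewrite !(nd (west i j)) ?degenerate_east_west// !(nd (north i j)) ?degenerate_inr//.
rewrite !(nd (south i j)) ?degenerate_inr// => /eqP <-; rewrite eqn_add2r.
by case: (w1 _); case: (w2 _).
Qed.

Lemma foldable_untwisted (mu : {ffun crease L -> mv}) :
  (forall i j, foldable_at mu i j) ->
  exists2 w : {ffun piece -> mv}, w \in ice_configurations & mu = untwisted w.
Proof.
move=> fold.
(* The default [false] is taken only at contracted pieces, to which [w] below gives another
   value. *)
pose u p := (if insub p is Some c then mu c else false) (+) twist p.
(* A contracted heel receives the common sum of the toes of the merged feet. *)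
pose w := [ffun p => match p with
  | inl (a, b) => if degenerate p then
      if unlift ord0 b is Some j
      then (1 < u (west a j) + u (north a j) + ~~ u (south a j))%N else false
    else u p
  | inr _ => u p end].
have w_nd p : ~~ degenerate p -> w p = u p.
  by rewrite ffunE; case: p => [[a b]|//] /negbTE->.
have w_d i j : degenerate (east i j) ->
    w (east i j) = (1 < w (west i j) + w (north i j) + ~~ w (south i j))%N.
  move=> dE; rewrite (w_nd (west i j)) ?degenerate_east_west//.
  rewrite (w_nd (north i j)) ?(w_nd (south i j)) ?degenerate_inr//.
  by rewrite ffunE dE /east liftK.
have muE : mu = untwisted w.
  apply/ffunP => c; rewrite ffunE w_nd ?(valP c)// /u valK.
  by rewrite -addbA addbb addbF.
exists w => //; apply/ice_configurationsP => i j.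
(* The first equation forces the [h] of [foldable_at_waterbomb] to be the value chosen in [w_d], so
   the two equations are the ice rules of both feet. *)
have bomb k (k2 : 'I_n) : degenerate (east i k) -> k2 = k.+1 :> nat -> east i k = west i k2 ->
    ice_rule w i k /\ ice_rule w i k2.
  move=> dE kE eE; have := fold i k; rewrite muE => /(foldable_at_waterbomb w dE kE)[h].
  rewrite /ice_rule -eE (w_d i k dE).
  by case: h => -[]; do 6 case: (w _).
have [dE|ndE] := boolP (degenerate (east i j)).
  by have [j2 [j2E eE _ _]] := degenerate_east_turn dE; case: (bomb j j2).
have [dW|ndW] := boolP (degenerate (west i j)).
  have [j1 [jE eE _]] := degenerate_west_turn dW.
  by case: (bomb j1 j); rewrite // eE.
by apply/eqP/foldable_at_foot => //; rewrite -muE.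
Qed.

Lemma num_locally_validE : num_locally_valid L = #|ice_configurations|.
Proof.
rewrite -(card_in_imset untwisted_inj); apply: eq_card => mu.
rewrite inE; apply/asboolP/imsetP => [/locally_validE|[w /ice_configurationsP ice ->]].
- exact: foldable_untwisted.
- by apply/locally_validE; exact: ice_foldable_at.
Qed.

End Vertex.

(** * Comparison of the patterns *)

(** Coinciding vertices would be a common point of disjoint zig-zags, so the angle condition at
    waterbomb vertices holds vacuously. *)
Lemma modified_miura_ori_snake (R : realType) (m n : nat) (L : zigzag_pattern R m.+1 n.+1) :
  modified_miura_ori L -> snake_tessellation L.
Proof.
move=> [wd disj]; split=> // [j k j0 jk kn|i j /andP[i0 im] j0 jn e]; first by left; exact: disj.
suff : (set0 : set (R * R)) (zigzag_point L i j) by [].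
rewrite -(disj j j.+1)//; split; exists i, 0; split=> //; rewrite ?lexx ?ler01 //.
- by rewrite subr0 !mul1r !mul0r !addr0 -surjective_pairing.
- by rewrite subr0 !mul1r !mul0r !addr0 -surjective_pairing.
Qed.

Theorem theorem7 (R : realType) (m n : nat) (hm : (0 < m)%N) (hn : (0 < n)%N)
    (S : zigzag_pattern R m n) (hS : snake_tessellation S) :
  (forall M : zigzag_pattern R m n, standard_miura_ori M ->
     num_locally_valid S = num_locally_valid M) /\
  (forall M : zigzag_pattern R m n, modified_miura_ori M ->
     num_locally_valid S = num_locally_valid M).
Proof.
suff H : forall M : zigzag_pattern R m n, modified_miura_ori M ->
    num_locally_valid S = num_locally_valid M.
  by split=> // M [/H].
case: m n hm hn S hS => [//|m'] [//|n'] _ _ S hS M /modified_miura_ori_snake hM.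
by rewrite !num_locally_validE.
Qed.
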